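(* Let $E$ be the set of irrational $x\in(0,1)$ for which there exists a constant $K_x$ with $g_k(x)\le K_x$ for all $k\in\mathbb N$ (numbers with bounded $\bar O^1$-symbols). Then $E$ has Lebesgue measure $0$.
   Context: Every irrational $x\in(0,1)$ has a unique expansion $x=\sum_{n\ge1}\frac{(-1)^{n-1}}{g_1(g_1+g_2)\cdots(g_1+\dots+g_n)}$ with all $g_n\in\mathbb N$; $g_n=g_n(x)$ is the $n$-th $\bar O^1$-symbol of $x$. *)

(* Defs.v *)
From mathcomp Require Import all_boot all_order all_algebra.
From mathcomp Require Import all_classical all_reals all_analysis.
Import Order.TTheory GRing.Theory Num.Theory.
Import numFieldNormedType.Exports.

Set Implicit Arguments.
Unset Strict Implicit.
Unset Printing Implicit Defensive.

Local Open Scope classical_set_scope.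
Local Open Scope ring_scope.

(* Symbols are indexed from 0: the value [g n] stands for g_{n+1}, so that
   [O1_term R g n] is
     (-1)^n / (g_1 (g_1 + g_2) ... (g_1 + ... + g_{n+1})). *)
Definition O1_term (R : realType) (g : nat -> nat) (n : nat) : R :=
  (-1) ^+ n / (\prod_(k < n.+1) \sum_(i < k.+1) g i)%N%:R.

Definition is_O1_expansion (R : realType) (x : R) (g : nat -> nat) : Prop :=
  (forall n, (0 < g n)%N) /\ series (O1_term R g) @ \oo --> x.

(* Every irrational x in ]0, 1[ has exactly one such expansion, which
   [O1_symbol x] selects; the default value (constantly 0) is only reached at
   numbers x without any expansion. *)
Definition O1_symbol (R : realType) (x : R) : nat -> nat :=
  xget (fun=> 0%N) [set g | is_O1_expansion x g].

Definition bounded_O1_symbols (R : realType) : set R :=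
  [set x | irrational x /\ 0 < x < 1 /\
           exists K : nat, forall n, (O1_symbol x n <= K)%N].
Arguments bounded_O1_symbols : clear implicits.

(* Main.v *)
(** Writing [q n = g 0 + ... + g n], an expansion of [x] is an alternating
    series with terms of modulus [1 / (q 0 * ... * q n)], and [q k >= k + 1].
    Hence the first [n] symbols determine [x] up to an error [1 / n!].  If all
    symbols are bounded by [K], there are at most [(K + 1) ^ n] possible
    beginnings of length [n], so the numbers with symbols bounded by [K] are
    covered by closed balls of total length [2 (K + 1) ^ n / n!], which tends
    to 0.  Every irrational of ]0, 1[ does have an expansion: the greedy
    algorithm [y |-> 1 - q y] with [q] the integer part of [1 / y] yields the
    increasing sequence of the [q n]. *)
Require Import Defs.
From mathcomp Require Import all_boot all_order all_algebra.
From mathcomp Require Import all_classical all_reals all_analysis.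
From mathcomp Require Import measurable_realfun.
From mathcomp Require Import ring lra.
Import Order.TTheory GRing.Theory Num.Theory.
Import numFieldNormedType.Exports.

Set Implicit Arguments.
Unset Strict Implicit.
Unset Printing Implicit Defensive.

Local Open Scope classical_set_scope.
Local Open Scope ring_scope.

(** * Truncation error of an expansion *)

Lemma leq_sum_positive (g : nat -> nat) (n : nat) :
  (forall i, 0 < g i)%N -> (n <= \sum_(i < n) g i)%N.
Proof.
move=> g0; rewrite -[leqLHS]card_ord -sum1_card.
exact: leq_sum.
Qed.

Lemma leq_fact_prod_sum (g : nat -> nat) (n : nat) :
  (forall i, 0 < g i)%N -> (n`! <= \prod_(k < n) \sum_(i < k.+1) g i)%N.
Proof.
move=> g0; elim: n => [|n IHn]; first by rewrite big_ord0.
rewrite factS big_ord_recr/= mulnC leq_mul//.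
exact: leq_sum_positive.
Qed.

Lemma eq_O1_term (R : realType) (g h : nat -> nat) (n : nat) :
  (forall i, (i <= n)%N -> g i = h i) -> O1_term R g n = O1_term R h n.
Proof.
move=> gh; congr (_ / _%:R); apply: eq_bigr => k _.
by apply: eq_bigr => i _; apply: gh; rewrite (leq_trans (leq_ord i)) ?leq_ord.
Qed.

Lemma norm_O1_term_le (R : realType) (g : nat -> nat) (n : nat) :
  (forall i, 0 < g i)%N -> `|O1_term R g n| <= (n.+1`!%:R)^-1.
Proof.
move=> g0; rewrite /O1_term normrM normrX normrN1 expr1n mul1r normfV normr_nat.
rewrite lef_pV2 ?posrE ?ltr0n ?fact_gt0// ?ler_nat ?leq_fact_prod_sum//.
by rewrite (leq_trans (fact_gt0 n.+1))// leq_fact_prod_sum.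
Qed.

(** The term of index [k.+1] has modulus at most [1 / (k+2)!], which is at most
    [1 / (k+1)! - 1 / (k+2)!], so the bounds telescope. Keeping the subtracted term lets the
    induction on [m - n] close. *)
Lemma O1_partial_sums_dist (R : realType) (g : nat -> nat) (n m : nat) :
  (forall i, 0 < g i)%N -> (n <= m)%N ->
  `|series (O1_term R g) m.+1 - series (O1_term R g) n.+1| <=
    (n.+1`!%:R)^-1 - (m.+1`!%:R)^-1.
Proof.
move=> g0 /subnKC <-; elim: (m - n)%N => [|d IHd].
  by rewrite addn0 !subrr normr0.
rewrite addnS; set k := (n + d)%N in IHd *.
rewrite (seriesSr _ k.+1) addrAC.
apply: (le_trans (ler_normD _ _)).
have hk := @norm_O1_term_le R g k.+1 g0.
have : (k.+2`!%:R)^-1 + (k.+2`!%:R)^-1 <= (k.+1`!%:R)^-1 :> R.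
  rewrite factS natrM invfM -mulr2n -mulrnAl ger_pMl ?invr_gt0 ?ltr0n ?fact_gt0//.
  by rewrite -mulr_natl ler_pdivrMr ?ltr0n// mul1r ler_nat.
move: IHd hk; lra.
Qed.

Lemma O1_expansion_dist (R : realType) (x : R) (g : nat -> nat) (n : nat) :
  is_O1_expansion x g ->
  `|series (O1_term R g) n.+1 - x| <= (n.+1`!%:R)^-1.
Proof.
move=> [g0 gx].
have cvgd : `|series (O1_term R g) n.+1 - series (O1_term R g) m| @[m --> \oo]
    --> `|series (O1_term R g) n.+1 - x|.
  by apply: cvg_norm; apply: cvgB => //; exact: cvg_cst.
apply: (ler_cvg_to cvgd (cvg_cst ((n.+1`!%:R)^-1 : R))).
near=> m.
have nm : (n.+1 <= m)%N by near: m; exact: nbhs_infty_ge.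
(* The previous bound counts terms as successors, hence [m] is written as [m.-1.+1]. *)
rewrite -(ltn_predK nm) distrC (le_trans (@O1_partial_sums_dist R g n m.-1 g0 _))//.
  by rewrite -ltnS (ltn_predK nm).
by rewrite gerBl invr_ge0.
Unshelve. all: by end_near. Qed.

Lemma cvg_fact_inv (R : realType) : (n`!%:R)^-1 @[n --> \oo] --> (0 : R).
Proof.
rewrite (_ : (fun n => _) = exp_coeff (1 : R)); first exact: cvg_exp_coeff.
by apply/funext => n; rewrite /exp_coeff/= expr1n mul1r.
Qed.

(** * Existence of expansions by the greedy algorithm *)

Section greedy_expansion.
Context {R : realType}.
Implicit Types x y : R.

Definition pierce_digit y : nat := Num.truncn y^-1.
Definition pierce_map y : R := 1 - (pierce_digit y)%:R * y.
Definition pierce_rem x (n : nat) : R := iter n pierce_map x.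
(** The digits of the Pierce expansion are the partial sums of the symbols, so the symbols are their
    differences. The truncated subtraction is exact because the digits increase for irrational [x]
    in ]0, 1[. *)
Definition pierce_symbol x (n : nat) : nat :=
  if n is m.+1 then
    (pierce_digit (pierce_rem x m.+1) - pierce_digit (pierce_rem x m))%N
  else pierce_digit (pierce_rem x 0).

Lemma pierce_digit_gt0 y : 0 < y < 1 -> (0 < pierce_digit y)%N.
Proof.
move=> /andP[y0 y1]; rewrite /pierce_digit truncn_ge_nat ?invr_ge0 ?ltW//.
by rewrite invf_gt1// ltW.
Qed.

Lemma irrational_neq (y r : R) : irrational y -> rational r -> y != r.
Proof. by move=> iy rr; apply/eqP => yr; apply: iy; rewrite yr. Qed.

Lemma irrational_pierce_map y :
  0 < y < 1 -> irrational y -> irrational (pierce_map y).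
Proof.
move=> /pierce_digit_gt0 q0 iy [a _ ay]; apply: iy.
exists ((1 - a) / (pierce_digit y)%:R) => //.
rewrite fmorph_div rmorphB /= rmorph1 ratr_nat ay /pierce_map opprB addrC subrK.
by rewrite mulrC mulKf// pnatr_eq0 -lt0n.
Qed.

(** With [q] the digit, [q <= 1 / y] gives [1 - q y >= 0], and irrationality excludes 0. From
    [y > 1 / (q+1)] follows [1 - q y < 1 - q / (q+1)]; this upper bound is what forces the next
    digit to be larger. *)
Lemma pierce_map_itv y : 0 < y < 1 -> irrational y ->
  0 < pierce_map y < ((pierce_digit y).+1%:R)^-1.
Proof.
move=> /[dup] yI /andP[y0 y1] iy.
have q0 := pierce_digit_gt0 yI.
have /andP[qle ltq] : (pierce_digit y)%:R <= y^-1 < (pierce_digit y).+1%:R.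
  by rewrite truncn_itv// invr_ge0 ltW.
have ltV : ((pierce_digit y).+1%:R)^-1 < y.
  by rewrite -[ltRHS]invrK ltf_pV2 ?posrE ?invr_gt0 ?ltr0n.
apply/andP; split.
  rewrite lt_neqAle eq_sym (irrational_neq (irrational_pierce_map yI iy)) /=.
    by rewrite subr_ge0 -ler_pdivlMr// mul1r.
  by exists 0 => //; rewrite rmorph0.
rewrite /pierce_map ltrBlDr -ltrBlDl.
move: ltV; rewrite -(ltr_pM2l (_ : 0 < (pierce_digit y)%:R)) ?ltr0n//.
apply: le_lt_trans; rewrite lerBlDr.
by rewrite -[X in _ + X]mul1r -mulrDl natr1 divff// pnatr_eq0.
Qed.

Lemma pierce_rem_spec x n : 0 < x < 1 -> irrational x ->
  0 < pierce_rem x n < 1 /\ irrational (pierce_rem x n).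
Proof.
move=> x01 ix; elim: n => [//|n [yI iy]]; split; last first.
  exact: irrational_pierce_map.
have /andP[-> /lt_le_trans->//] := pierce_map_itv yI iy.
by rewrite invf_le1 ?ltr0n// ler1n.
Qed.

Lemma ltn_pierce_digit x n : 0 < x < 1 -> irrational x ->
  (pierce_digit (pierce_rem x n) < pierce_digit (pierce_rem x n.+1))%N.
Proof.
move=> x01 ix; have [yI iy] := pierce_rem_spec n x01 ix.
have /andP[y0 yq] := pierce_map_itv yI iy.
rewrite [X in (_ < X)%N]/pierce_digit truncn_ge_nat ?invr_ge0 ?ltW//.
by rewrite -[ltLHS]invrK ltf_pV2 ?posrE ?invr_gt0 ?ltr0n.
Qed.

Lemma pierce_symbol_gt0 x n : 0 < x < 1 -> irrational x ->
  (0 < pierce_symbol x n)%N.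
Proof.
move=> x01 ix; case: n => [|n] /=; first exact: pierce_digit_gt0.
by rewrite subn_gt0 ltn_pierce_digit.
Qed.

Lemma sum_pierce_symbol x n : 0 < x < 1 -> irrational x ->
  (\sum_(i < n.+1) pierce_symbol x i)%N = pierce_digit (pierce_rem x n).
Proof.
move=> x01 ix; elim: n => [|n IHn]; first by rewrite big_ord1.
by rewrite big_ord_recr/= IHn subnKC// ltnW// ltn_pierce_digit.
Qed.

(** If [y'] is the remainder following [y], then [y = 1 / q - y' / q]: each step of the algorithm
    splits off one term of the series. *)
Lemma pierce_series_remainder x n : 0 < x < 1 -> irrational x ->
  x - series (O1_term R (pierce_symbol x)) n =
  (-1) ^+ n * pierce_rem x n /
    (\prod_(k < n) \sum_(i < k.+1) pierce_symbol x i)%N%:R.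
Proof.
move=> x01 ix; elim: n => [|n IHn].
  by rewrite /series/= big_geq// big_ord0 subr0 expr0 mul1r divr1.
rewrite seriesSr opprD addrA IHn /O1_term big_ord_recr/= sum_pierce_symbol// natrM.
have P0 : (\prod_(k < n) \sum_(i < k.+1) pierce_symbol x i)%N%:R != 0 :> R.
  rewrite pnatr_eq0 -lt0n (leq_trans (fact_gt0 n))// leq_fact_prod_sum// => i.
  exact: pierce_symbol_gt0.
have q0 : (pierce_digit (pierce_rem x n))%:R != 0 :> R.
  rewrite pnatr_eq0 -lt0n pierce_digit_gt0//.
  by have [] := pierce_rem_spec n x01 ix.
rewrite /pierce_map exprS.
by field; rewrite P0 q0.
Qed.

(** The remainder after [n] terms is a number in ]0, 1[ divided by a product that is at least
    [n!]. *)
Lemma is_O1_expansion_pierce_symbol x : 0 < x < 1 -> irrational x ->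
  is_O1_expansion x (pierce_symbol x).
Proof.
move=> x01 ix; have g0 n := @pierce_symbol_gt0 x n x01 ix; split => //.
apply/cvgrPdist_le => /= e e0.
near=> n; rewrite pierce_series_remainder// !normrM normrX normrN1 expr1n mul1r.
have [/andP[r0 r1] _] := pierce_rem_spec n x01 ix.
rewrite gtr0_norm// normfV normr_nat.
apply: (@le_trans _ _ (n`!%:R)^-1).
  rewrite -[leRHS]mul1r ler_pM ?invr_ge0//; [exact: ltW|exact: ltW|].
  rewrite lef_pV2 ?posrE ?ltr0n ?fact_gt0// ?ler_nat ?leq_fact_prod_sum//.
  by rewrite (leq_trans (fact_gt0 n))// leq_fact_prod_sum.
near: n; have /cvgr0Pnorm_le/(_ _ e0) := @cvg_fact_inv R.
by apply: filterS => n; apply: le_trans; exact: ler_norm.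
Unshelve. all: by end_near. Qed.

End greedy_expansion.

(** * Covers of vanishing measure *)

Lemma measure_bigsetU_le d (T : ringOfSetsType d) (R : realFieldType)
    (mu : {content set T -> \bar R}) (I : Type) (s : seq I) (F : I -> set T) :
  (forall i, measurable (F i)) ->
  (mu (\big[setU/set0]_(i <- s) F i) <= \sum_(i <- s) mu (F i))%E.
Proof.
move=> mF; elim: s => [|i s IHs]; first by rewrite !big_nil measure0.
rewrite !big_cons (le_trans (measureU2 _ _ _)) ?leeD2l//.
exact: bigsetU_measurable.
Qed.

(** The intersection of all [A n] is a measurable superset of [B] whose measure is below every
    positive [e]. *)
Lemma negligible_cvg_cover d (T : sigmaRingType d) (R : realType)
    (mu : {measure set T -> \bar R}) (B : set T) (A : (set T)^nat) (r : R^nat) :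
  (forall n, measurable (A n)) -> (forall n, B `<=` A n) ->
  (forall n, (mu (A n) <= (r n)%:E)%E) -> r @ \oo --> 0 ->
  mu.-negligible B.
Proof.
move=> mA BA mur r0.
have mI : measurable (\bigcap_n A n) by exact: bigcapT_measurable.
exists (\bigcap_n A n); split => //; last by move=> x Bx n _; exact: BA.
apply/eqP; rewrite -measure_le0; apply/lee_addgt0Pr => e e0.
rewrite add0e.
have /cvgr0Pnorm_le/(_ _ e0)[N _ /(_ N (leqnn _)) rN] := r0.
rewrite (le_trans (le_measure mu _ _ (_ : _ `<=` A N))) ?inE//.
  by move=> x /(_ N I).
by rewrite (le_trans (mur N))// lee_fin (le_trans (ler_norm _)).
Qed.

Section bounded_symbols.
Context {R : realType} (K : nat).

(* Only the values at indices below [n] matter for the [n]-th partial sum;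
   the value 0 elsewhere is junk. *)
Definition word_symbols (n : nat) (w : {ffun 'I_n -> 'I_K.+1}) (i : nat) : nat :=
  if insub i is Some j then w j else 0%N.

Definition word_ball (n : nat) (w : {ffun 'I_n.+1 -> 'I_K.+1}) : set R :=
  closed_ball (series (O1_term R (word_symbols w)) n.+1) (n.+1`!%:R)^-1.

Lemma bounded_expansion_sub_word_balls (x : R) (g : nat -> nat) (n : nat) :
  is_O1_expansion x g -> (forall i, (g i <= K)%N) ->
  (\big[setU/set0]_(w : {ffun 'I_n.+1 -> 'I_K.+1}) word_ball w) x.
Proof.
move=> gx gK; rewrite -bigcup_seq /=.
(* [inord] loses nothing here, since [g i <= K]. *)
pose w : {ffun 'I_n.+1 -> 'I_K.+1} := [ffun i : 'I_n.+1 => inord (g i)].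
exists w; first by rewrite /= mem_index_enum.
rewrite /word_ball closed_ballE ?invr_gt0 ?ltr0n ?fact_gt0//=.
rewrite /closed_ball_/= (_ : series _ _ = series (O1_term R g) n.+1).
  exact: O1_expansion_dist.
rewrite /series/=; apply: eq_big_nat => k /andP[_ kn].
apply: eq_O1_term => i ik; have iltn : (i < n.+1)%N by exact: leq_ltn_trans kn.
by rewrite /word_symbols insubT ffunE/= inordK// ltnS.
Qed.

Lemma negligible_bounded_expansions :
  (@lebesgue_measure R).-negligible
    [set x | exists2 g, is_O1_expansion x g & forall i, (g i <= K)%N].
Proof.
apply: (@negligible_cvg_cover _ _ _ (@lebesgue_measure R) _
  (fun n => \big[setU/set0]_(w : {ffun 'I_n.+1 -> 'I_K.+1}) word_ball w)
  (* There are [(K+1)^(n+1)] words, each with a ball of length [2 / (n+1)!]. The total is twice a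
     term of the exponential series at [K+1], hence tends to 0. *)
  (fun n => exp_coeff (K.+1%:R : R) n.+1 *+ 2)).
- by move=> n; apply: bigsetU_measurable => w _; exact: measurable_closed_ball.
- by move=> n x [g gx gK]; exact: bounded_expansion_sub_word_balls gK.
- move=> n; apply: le_trans.
    by apply: measure_bigsetU_le => w; exact: measurable_closed_ball.
  rewrite (eq_bigr (fun=> ((n.+1`!%:R)^-1 *+ 2)%:E)) => [|w _]; last first.
    by apply: lebesgue_measure_closed_ball; rewrite invr_ge0.
  rewrite sumEFin lee_fin sumr_const card_ffun !card_ord.
  by rewrite /exp_coeff/= -natrX -mulrnAr -[leLHS]mulr_natl.
- rewrite -[X in _ --> X](mul0rn _ 2); apply: cvgMn.
  by rewrite (cvg_shiftS (exp_coeff (K.+1%:R : R))); exact: cvg_exp_coeff.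
Qed.

End bounded_symbols.

Lemma negligible_bounded_O1_symbols (R : realType) :
  (@lebesgue_measure R).-negligible (bounded_O1_symbols R).
Proof.
apply: negligibleS (negligible_bigcup (@negligible_bounded_expansions R)).
move=> x [ix [x01 [K gK]]]; exists K => //=; exists (O1_symbol x) => //.
(* The greedy expansion rules out the default value of [xget], so [O1_symbol x] is itself an
   expansion. *)
apply: (@xgetPex _ _ [set g | is_O1_expansion x g]).
by exists (pierce_symbol x); exact: is_O1_expansion_pierce_symbol.
Qed.

Theorem theorem5 (R : realType) :
  (completed_algebra_gen (@lebesgue_measure R)).-sigma.-measurable
    (bounded_O1_symbols R) /\
  completed_lebesgue_measure (bounded_O1_symbols R) = 0%E.
Proof.
have neg := negligible_bounded_O1_symbols R; split.
- rewrite g_sigma_completed_algebra_genE.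
  (* A set of the completed algebra is a measurable set joined with a negligible one; here the
     measurable part is empty. *)
  by exists set0; [exact: measurable0|exists (bounded_O1_symbols R); rewrite ?set0U].
- exact/negligible_outer_measure.
Qed.
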